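(* The SS2-xn scheme satisfies Lorentz invariance: for every Lorentz matrix $L\in\mathrm O(1,3)$, the one-step map $\Psi_h:(\boldsymbol y^n,\boldsymbol u^n)\mapsto(\boldsymbol y^{n+1},\boldsymbol u^{n+1})$ of the scheme commutes with the change of inertial frame induced by $L$, i.e. $$\Psi_h'(L\boldsymbol y,L\boldsymbol u)=L\,\Psi_h(\boldsymbol y,\boldsymbol u),$$ where $L$ acts on the pair by $L(\boldsymbol y,\boldsymbol u)=(L\boldsymbol y,L\boldsymbol u)$ and $\Psi_h'$ is the same scheme written in the transformed frame, i.e. with the transformed electromagnetic tensor $\boldsymbol F'$ in place of $\boldsymbol F$.
   Context: Let $0<\varepsilon\ll1$. $\boldsymbol E=(E_1,E_2,E_3)^{\intercal}=-\nabla U$ is an electric field and $\boldsymbol B=(B_1,B_2,B_3)^{\intercal}$ a magnetic field on $\mathbb R^3$. The variables are $\boldsymbol y=(\boldsymbol x^{\intercal},\bar t)^{\intercal}$ and $\boldsymbol u=(\boldsymbol v^{\intercal},w)^{\intercal}$, 4-component vectors with spatial parts $\boldsymbol x,\boldsymbol v$ and $\bar t=it$, $w=i\gamma$. The relativistic charged-particle system is $\dot{\boldsymbol y}=\boldsymbol u$, $\dot{\boldsymbol u}=\boldsymbol F(\boldsymbol x)\boldsymbol u$ with $$\boldsymbol F(\boldsymbol x)=\frac{\widehat{\widehat{\boldsymbol B}}(\varepsilon\boldsymbol x)}{\varepsilon}+\widehat{\boldsymbol E}(\boldsymbol x),\quad \widehat{\widehat{\boldsymbol B}}=\begin{pmatrix}\widehat{\boldsymbol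 B}&\boldsymbol 0\\ \boldsymbol 0&0\end{pmatrix},\quad \widehat{\boldsymbol B}=\begin{pmatrix}0&B_3&-B_2\\ -B_3&0&B_1\\ B_2&-B_1&0\end{pmatrix},\quad \widehat{\boldsymbol E}=\begin{pmatrix}\boldsymbol 0&-i\boldsymbol E\\ i\boldsymbol E^{\intercal}&0\end{pmatrix}.$$ **SS2-xn scheme.** With step $h>0$ and $\varphi_1(s)=(\mathrm e^s-1)/s$ (entire function applied to matrices), $$\boldsymbol y^{n+1}=\boldsymbol y^n+\tfrac h2\varphi_1\!\big(\tfrac h2\boldsymbol F^n\big)\Big(I_4+\mathrm e^{h(\boldsymbol F_{\bar{\boldsymbol x}^n}-\boldsymbol F^n)}\mathrm e^{\frac h2\boldsymbol F^n}\Big)\boldsymbol u^n,\qquad \boldsymbol u^{n+1}=\mathrm e^{\frac h2\boldsymbol F^n}\mathrm e^{h(\boldsymbol F_{\bar{\boldsymbol x}^n}-\boldsymbol F^n)}\mathrm e^{\frac h2\boldsymbol F^n}\boldsymbol u^n,$$ where $\bar{\boldsymbol y}^n=\boldsymbol y^n+\frac h2\varphi_1(\frac h2\boldsymbol F^n)\boldsymbol u^n$, $\boldsymbol x^n$, $\bar{\boldsymbol x}^n$ are the first three components of $\boldsymbol y^n$, $\bar{\boldsymbol y}^n$, $\boldsymbol F^n=\boldsymbol F(\boldsymbol x^n)$, $\boldsymbol F_{\bar{\boldsymbol x}^n}=\boldsymbol F(\bar{\boldsymbol x}^n)$. **Lorentz transformation.** A Lorentz matrix is a $4\times4$ matrix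 $L\in\mathrm O(1,3)$, i.e. $L^{\intercal}gL=g$ with $g$ the Minkowski metric. It transforms states from an inertial frame to another by $\boldsymbol y'=L\boldsymbol y$, $\boldsymbol u'=L\boldsymbol u$, and the electromagnetic tensor by $\boldsymbol F'=L\boldsymbol F L^{-1}$ at corresponding points. Regarding $\boldsymbol F$ as a function of $\boldsymbol y$ through its spatial part, $\boldsymbol F'$ is thus the matrix function of $\boldsymbol y'$ with $\boldsymbol F'(L\boldsymbol y)=L\,\boldsymbol F(\boldsymbol x)\,L^{-1}$, $\boldsymbol x$ being the first three components of $\boldsymbol y$. In the transformed frame the scheme uses $\boldsymbol F'$ evaluated at $\boldsymbol y'^n$ and at $\bar{\boldsymbol y}'^n=\boldsymbol y'^n+\frac h2\varphi_1(\frac h2\boldsymbol F'(\boldsymbol y'^n))\boldsymbol u'^n$ in place of $\boldsymbol F^n$ and $\boldsymbol F_{\bar{\boldsymbol x}^n}$. *)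

(* Defs.v *)
From HB Require Import structures.
From mathcomp Require Import all_boot all_order all_algebra.
From mathcomp Require Import complex.
From mathcomp Require Import all_classical all_reals all_analysis.

Set Implicit Arguments.
Unset Strict Implicit.
Unset Printing Implicit Defensive.

Import Order.TTheory GRing.Theory Num.Theory.
Import numFieldNormedType.Exports.

Local Open Scope classical_set_scope.
Local Open Scope ring_scope.
Local Open Scope complex_scope.

(* The entire function s |-> \sum_k (c k) s^k applied to a square matrix;
   the limit is taken in the normed space of matrices. *)
Definition entire_mx (K : numFieldType) (n : nat) (c : nat -> K)
    (A : 'M[K]_n.+1) : 'M[K]_n.+1 :=
  lim ((series (fun k : nat => c k *: A ^+ k) : nat -> 'M[K]_n.+1) @ \oo).

Definition exp_mx (K : numFieldType) (n : nat) (A : 'M[K]_n.+1) :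
    'M[K]_n.+1 :=
  entire_mx (fun k => (k`!)%:R^-1) A.

(* (e^s - 1) / s = \sum_k s^k / (k + 1)! *)
Definition phi1_mx (K : numFieldType) (n : nat) (A : 'M[K]_n.+1) :
    'M[K]_n.+1 :=
  entire_mx (fun k => (k.+1`!)%:R^-1) A.

Section Fields.
Variable R : realType.
Local Notation C := R[i].

Definition grad (U : 'cV[R]_3 -> R) (x : 'cV[R]_3) : 'cV[R]_3 :=
  \col_i 'D_(delta_mx i 0) U x.

Definition hatB (b : 'cV[R]_3) : 'M[R]_3 :=
  let b1 := b 0 0 in let b2 := b 1 0 in let b3 := b 2 0 in
  \matrix_(i, j) nth 0 (nth [::]
    [:: [::   0;  b3; - b2];
        [:: - b3;   0;  b1];
        [::  b2; - b1;   0]] i) j.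

Definition hathatB (b : 'cV[R]_3) : 'M[C]_4 :=
  block_mx (map_mx (real_complex R) (hatB b)) (0 : 'cV[C]_3)
           (0 : 'rV[C]_3) (0 : 'M[C]_1).

Definition hatE (e : 'cV[R]_3) : 'M[C]_4 :=
  let eC := map_mx (real_complex R) e in
  block_mx (0 : 'M[C]_3) (- 'i *: eC) ('i *: eC^T) (0 : 'M[C]_1).

Definition em_tensor (eps : R) (E B : 'cV[R]_3 -> 'cV[R]_3) (x : 'cV[R]_3) :
    'M[C]_4 :=
  (eps^-1)%:C *: hathatB (B (eps *: x)) + hatE (E x).

(* The 4-component vector (x, i s), used for positions (x, i t) and for
   velocities (v, i gamma). *)
Definition fourvec (x : 'cV[R]_3) (s : R) : 'cV[C]_4 :=
  col_mx (map_mx (real_complex R) x) (const_mx ('i * s%:C) : 'cV[C]_1).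

(* On a vector (x, i s) with x real this is x: the real part is there only
   because the fields are functions on R^3. *)
Definition spatial (y : 'cV[C]_4) : 'cV[R]_3 :=
  map_mx (@complex.Re R) (usubmx (y : 'cV[C]_(3 + 1))).

Lemma spatial_fourvec (x : 'cV[R]_3) (s : R) : spatial (fourvec x s) = x.
Proof.
by rewrite /spatial /fourvec col_mxKu; apply/matrixP => i j; rewrite !mxE.
Qed.

(* The scheme for a tensor G given as a function of the whole 4-vector y, as is
   needed in a transformed frame, where the tensor depends on all of y'. *)
Definition ss2_mid (G : 'cV[C]_4 -> 'M[C]_4) (h : R) (y u : 'cV[C]_4) :
    'cV[C]_4 :=
  y + (h / 2)%:C *: (phi1_mx ((h / 2)%:C *: G y) *m u).

Definition ss2_step (G : 'cV[C]_4 -> 'M[C]_4) (h : R)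
    (p : 'cV[C]_4 * 'cV[C]_4) : 'cV[C]_4 * 'cV[C]_4 :=
  let: (y, u) := p in
  let Gn := G y in
  let Gbar := G (ss2_mid G h y u) in
  let expF := exp_mx ((h / 2)%:C *: Gn) in
  let expD := exp_mx (h%:C *: (Gbar - Gn)) in
  (y + (h / 2)%:C *:
         (phi1_mx ((h / 2)%:C *: Gn) *m (1%:M + expD *m expF) *m u),
   expF *m expD *m expF *m u).

(* Time is the last coordinate, as in y = (x, i t). *)
Definition minkowski : 'M[R]_4 :=
  block_mx (1%:M : 'M[R]_3) (0 : 'cV[R]_3) (0 : 'rV[R]_3) ((-1)%:M : 'M[R]_1).

(* L \in O(1,3); O(1,3) is the same group for the metric with opposite sign. *)
Definition lorentz (L : 'M[R]_4) : Prop :=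
  L^T *m minkowski *m L = minkowski.

Definition frame_change (L : 'M[C]_4) (p : 'cV[C]_4 * 'cV[C]_4) :
    'cV[C]_4 * 'cV[C]_4 :=
  (L *m p.1, L *m p.2).

End Fields.

(* Main.v *)
Require Import Defs.
From HB Require Import structures.
From mathcomp Require Import all_boot all_order all_algebra.
From mathcomp Require Import complex.
From mathcomp Require Import all_classical all_reals all_analysis.

Import Order.TTheory GRing.Theory Num.Theory.
Import numFieldNormedType.Exports.

Local Open Scope classical_set_scope.
Local Open Scope ring_scope.
Local Open Scope complex_scope.

(** The scheme is built from the tensor by sums, scalings, products and the
    functions exp and phi1 of matrices, all of which commute with conjugation
    by an invertible matrix P: replacing F by P F P^-1 turns every matrix M of
    the scheme into P M P^-1, and the factors P^-1 P between a matrix and the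
    transformed state cancel.  This gives the equivariance lemma
    [ss2_step_frame_change], valid for any invertible P.  A Lorentz matrix is
    invertible because (g L^T g) L = 1, g being the metric.

    The lemma needs the law F' (P y) = P (F y) P^-1 at the two points where the
    scheme evaluates the tensor: the current position and the midpoint.  The
    transformation law is known only at vectors (x, i s) with x and s real, so
    the midpoint has to be shown to be such a vector.  These vectors are those
    with conj y = g y.  The tensor satisfies the matching relation
    conj F = g F g^-1, and phi1 inherits it, since its coefficients are real and
    it commutes both with entrywise conjugation and with conjugation by g.
    Hence phi1 (h/2 F) u is again of that form ([wick_real_mid]).

    Both commutation properties of entire functions are instances of
    [entire_mx_morph]: an additive homeomorphism of the matrix space that
    respects the monomials of the series respects its sum. *)

(** * Continuity of the symmetries of the matrix space *)

Lemma continuous_mx (K : numFieldType) (T : topologicalType) (m n : nat)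
    (f : T -> 'M[K]_(m, n)) :
  (forall i j, continuous (fun x => f x i j)) -> continuous f.
Proof.
move=> fc x A [P xP sPA].
apply: (filterS (P := fun y => forall i j, P i j (f y i j))) => [y /sPA //|].
by apply: filter_forall => i; apply: filter_forall => j; apply: fc.
Qed.

Lemma continuous_mulmx2 (K : numFieldType) (m n p q : nat)
    (P : 'M[K]_(m, n)) (Q : 'M[K]_(p, q)) :
  continuous (fun A : 'M[K]_(n, p) => P *m A *m Q).
Proof.
apply: continuous_mx => i j.
rewrite (_ : (fun A => _) = (fun A : 'M[K]_(n, p) =>
    \sum_k \sum_l P i l * A l k * Q k j)); last first.
  apply/funext => A; rewrite mxE; apply: eq_bigr => k _.
  by rewrite mxE mulr_suml.
apply: continuous_big => [|k _]; first exact: add_continuous.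
apply: continuous_big => [|l _ A]; first exact: add_continuous.
refine (@continuousM K _ (fun M : 'M[K]_(n, p) => P i l * M l k)
  (fun=> Q k j) A _ _); last exact: cst_continuous.
refine (@continuousM K _ (fun=> P i l) (fun M : 'M[K]_(n, p) => M l k) A _ _).
  exact: cst_continuous.
exact: coord_continuous.
Qed.

(** The isometry hypothesis is the form in which the continuity of complex
    conjugation is available over an abstract field. *)
Lemma continuous_map_mx (K : numFieldType) (f : {additive K -> K})
    (m n : nat) : (forall z, `|f z| = `|z|) ->
  continuous (fun A : 'M[K]_(m, n) => map_mx f A).
Proof.
move=> f_norm; apply: continuous_mx => i j.
rewrite (_ : (fun A => _) = (fun A : 'M[K]_(m, n) => f (A i j)));
  last by apply/funext => A; rewrite mxE.
have f_cont : continuous (f : K -> K).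
  move=> z S /= /(nbhs_ballP (f z)) [e e0 sS].
  apply/nbhs_ballP; exists e => //= y zy; apply: sS.
  by rewrite /ball /= -raddfB f_norm.
by move=> A; apply: continuous_comp; [exact: coord_continuous | exact: f_cont].
Qed.

(** * Entire functions of matrices and their symmetries *)

(** On partial sums the identity is algebra; continuity of [s] carries it to the
    limit when the series of [A] converges.  When it diverges, so does that of
    [s A], because [s'] is continuous; both limits then have the default value
    0, which [s] fixes. *)
Lemma entire_mx_morph (K : numFieldType) (n : nat) (c : nat -> K)
    (s s' : 'M[K]_n.+1 -> 'M[K]_n.+1) :
  continuous s -> continuous s' -> cancel s s' -> cancel s' s ->
  {morph s : A B / A + B} ->
  (forall k A, s (c k *: A ^+ k) = c k *: s A ^+ k) ->
  forall A, entire_mx c (s A) = s (entire_mx c A).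
Proof.
move=> sc s'c sK s'K sD sZX A; rewrite /entire_mx.
have s0 : s 0 = 0 by apply: (@addrI _ (s 0)); rewrite -sD !addr0.
have sS : series (fun k => c k *: s A ^+ k) =
    s \o series (fun k => c k *: A ^+ k).
  apply/funext => m /=; rewrite /series /= (big_morph s sD s0).
  by apply: eq_bigr => k _; rewrite sZX.
rewrite sS; set u := series _.
have [uc|ud] := pselect (cvg (u @ \oo)).
  apply/cvg_lim; first exact: norm_hausdorff.
  by apply: continuous_cvg => //; exact: sc.
have sud : ~ cvg (s \o u @ \oo).
  move=> suc; apply: ud.
  have -> : u = s' \o (s \o u) by apply/funext => m /=; rewrite sK.
  apply/cvg_ex; exists (s' (lim (s \o u @ \oo))).
  exact: (cvg_comp (s \o u) s' suc (s'c _)).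
rewrite (dvgP ud) (dvgP sud).
have -> : point = 0 :> 'M[K]_n.+1 by apply/matrixP => i j; rewrite !mxE.
by rewrite s0.
Qed.

Lemma entire_mx_conj (K : numFieldType) (n : nat) (c : nat -> K)
    (P A : 'M[K]_n.+1) : P \in unitmx ->
  entire_mx c (P *m A *m invmx P) = P *m entire_mx c A *m invmx P.
Proof.
move=> uP.
apply: (entire_mx_morph _ _ _ (fun M => P *m M *m invmx P)
    (fun M => invmx P *m M *m P)).
- exact: continuous_mulmx2.
- exact: continuous_mulmx2.
- by move=> M; rewrite !mulmxA mulVmx // mul1mx mulmxKV.
- by move=> M; rewrite !mulmxA mulmxV // mul1mx mulmxK.
- by move=> M N; rewrite mulmxDr mulmxDl.
- move=> k M; rewrite -scalemxAr -scalemxAl; congr (_ *: _).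
  elim: k => [|k IHk]; first by rewrite !expr0 mulmx1 mulmxV.
  by rewrite !exprS -IHk -!mulmxE !mulmxA mulmxKV.
Qed.

(** To be used with complex conjugation for [f] and real coefficients [c]. *)
Lemma entire_mx_map (K : numFieldType) (f : {rmorphism K -> K}) (n : nat)
    (c : nat -> K) (A : 'M[K]_n.+1) :
  involutive f -> (forall z, `|f z| = `|z|) -> (forall k, f (c k) = c k) ->
  entire_mx c (map_mx f A) = map_mx f (entire_mx c A).
Proof.
move=> fK f_norm fc.
have map_fK : involutive (map_mx f : 'M[K]_n.+1 -> _).
  by move=> M; apply/matrixP => i j; rewrite !mxE fK.
apply: (entire_mx_morph _ _ _ (map_mx f) (map_mx f)) => //.
- exact: continuous_map_mx.
- exact: continuous_map_mx.
- by move=> M N; rewrite map_mxD.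
- by move=> k M; rewrite map_mxZ fc rmorphXn.
Qed.

Lemma entire_mx_conjZ (K : numFieldType) (n : nat) (c : nat -> K) (a : K)
    (P A : 'M[K]_n.+1) : P \in unitmx ->
  entire_mx c (a *: (P *m A *m invmx P)) =
  P *m entire_mx c (a *: A) *m invmx P.
Proof. by move=> uP; rewrite -entire_mx_conj // -scalemxAr -scalemxAl. Qed.

(** * States with real space part and imaginary time part *)

Section WickReality.
Variable R : realType.
Local Notation C := R[i].

Definition minkowskiC : 'M[C]_4 := map_mx (real_complex R) (Defs.minkowski R).

(** The metric changes the sign of the last coordinate only, so the equation
    says that the first three coordinates are real and the last one imaginary.  In
    this form the condition is equational, hence passes through matrix
    functions. *)
Definition wick_real_vec (y : 'cV[C]_4) : Prop :=
  map_mx (@conjc R) y = minkowskiC *m y.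

(** The condition on a linear map [A] for it to preserve [wick_real_vec]. *)
Definition wick_real_mx (A : 'M[C]_4) : Prop :=
  map_mx (@conjc R) A = minkowskiC *m A *m invmx minkowskiC.

Lemma minkowski_sqr : Defs.minkowski R *m Defs.minkowski R = 1%:M.
Proof.
(* The block sizes have to be given: 4 does not unify with a sum of variables. *)
rewrite /Defs.minkowski (@mulmx_block _ 3 1 3 1 3 1).
rewrite !mul0mx !mulmx0 !addr0 !add0r mulmx1.
by rewrite -scalar_mxM mulrNN mulr1 -(@scalar_mx_block _ 3 1).
Qed.

(** The matrix g L^T g is a left inverse of [L]. *)
Lemma lorentz_unitmx (L : 'M[R]_4) : lorentz L -> L \in unitmx.
Proof.
move=> hL.
have /mulmx1_unit[] // :
  Defs.minkowski R *m L^T *m Defs.minkowski R *m L = 1%:M.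
by rewrite -!mulmxA (mulmxA L^T) hL minkowski_sqr.
Qed.

Lemma minkowskiC_unit : minkowskiC \in unitmx.
Proof. by rewrite map_unitmx; have /mulmx1_unit[] := minkowski_sqr. Qed.

Lemma minkowskiC_block : minkowskiC =
  block_mx (1%:M : 'M[C]_3) (0 : 'cV[C]_3) (0 : 'rV[C]_3) ((-1)%:M : 'M[C]_1).
Proof.
rewrite /minkowskiC /Defs.minkowski (@map_block_mx _ _ _ 3 1 3 1).
by rewrite !map_mx0 map_mx1 map_scalar_mx rmorphN rmorph1.
Qed.

Lemma map_conjcZ m n (z : C) (A : 'M[C]_(m, n)) :
  map_mx (@conjc R) (z *: A) = z^*%C *: map_mx (@conjc R) A.
Proof. exact: map_mxZ. Qed.

Lemma conjc_real_mx m n (A : 'M[R]_(m, n)) :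
  map_mx (@conjc R) (map_mx (real_complex R) A) = map_mx (real_complex R) A.
Proof. by apply/matrixP => i j; rewrite !mxE conjc_real. Qed.

Lemma wick_real_fourvec (x : 'cV[R]_3) (s : R) : wick_real_vec (fourvec x s).
Proof.
rewrite /wick_real_vec /fourvec minkowskiC_block.
rewrite (@map_col_mx _ _ _ 3 1 1) (@mul_block_col _ 3 1 3 1 1).
rewrite conjc_real_mx !mul1mx !mul0mx addr0 add0r mul_scalar_mx scaleN1r.
apply: (f_equal2 (@col_mx C 3 1 1)) => //.
apply/matrixP => i j; rewrite !mxE.
by simpc.
Qed.

Lemma wick_realP (y : 'cV[C]_4) :
  wick_real_vec y -> exists x s, y = fourvec x s.
Proof.
rewrite /wick_real_vec -[y](@vsubmxK _ 3 1 1) minkowskiC_block.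
rewrite (@map_col_mx _ _ _ 3 1 1) (@mul_block_col _ 3 1 3 1 1).
rewrite !mul1mx !mul0mx addr0 add0r mul_scalar_mx scaleN1r.
move: (usubmx _) (dsubmx _) => a b.
move=> /(@eq_col_mx _ 3 1 1)[/matrixP ha /matrixP hb].
exists (map_mx (@complex.Re R) a), (complex.Im (b 0 0)); rewrite /fourvec.
apply: (f_equal2 (@col_mx C 3 1 1)); apply/matrixP => i j; rewrite !mxE.
  have := ha i j; rewrite mxE; case: (a i j) => p q /= [/eqP].
  by rewrite eqNr => /eqP ->.
have := hb i j; rewrite !mxE !ord1; case: (b 0 0) => p q /= [/eqP].
by rewrite eq_sym eqNr => /eqP ->; simpc.
Qed.

(** The magnetic block is real and untouched by g; the electric blocks are
    imaginary, and g changes their sign since each meets the time coordinate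
    once. *)
Lemma wick_real_em_tensor (eps : R) (E B : 'cV[R]_3 -> 'cV[R]_3) x :
  wick_real_mx (em_tensor eps E B x).
Proof.
(* As g is invertible, it is enough to compare conj F g with g F. *)
suff H : map_mx (@conjc R) (em_tensor eps E B x) *m minkowskiC
    = minkowskiC *m em_tensor eps E B x.
  by rewrite /wick_real_mx -H mulmxK // minkowskiC_unit.
rewrite /em_tensor map_mxD map_conjcZ mulmxDl mulmxDr.
rewrite -scalemxAl -scalemxAr /hathatB /hatE minkowskiC_block.
rewrite !(@map_block_mx _ _ _ 3 1 3 1).
rewrite !(@mulmx_block _ 3 1 3 1 3 1).
rewrite !(mulmx0, mul0mx, addr0, add0r, mulmx1, mul1mx, map_mx0).
rewrite conjc_real conjc_real_mx; congr (_ + _).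
have [conj_i conj_Ni] :
    ('i%R)^*%C = - 'i%R :> C /\ (- 'i%R)^*%C = 'i%R :> C.
  by split; simpc.
rewrite !(mul_scalar_mx, mul_mx_scalar, scaleN1r) !map_conjcZ map_trmx.
by rewrite !conjc_real_mx conj_i conj_Ni !scaleNr.
Qed.

(** The midpoint adds to [y] a real multiple of phi1 (h/2 G y) u, and phi1
    preserves the relation [wick_real_mx]. *)
Lemma wick_real_mid (G : 'cV[C]_4 -> 'M[C]_4) (h : R) (y u : 'cV[C]_4) :
  wick_real_mx (G y) -> wick_real_vec y -> wick_real_vec u ->
  wick_real_vec (ss2_mid G h y u).
Proof.
move=> hG hy hu; rewrite /wick_real_vec /ss2_mid map_mxD map_conjcZ map_mxM.
have conj_phi1 A :
    map_mx (@conjc R) (phi1_mx A) = phi1_mx (map_mx (@conjc R) A).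
  apply/esym/entire_mx_map => [z|z|k]; first exact: conjcK.
    exact: normcJ.
  by rewrite fmorphV rmorph_nat.
rewrite conj_phi1 map_conjcZ hG hy hu conjc_real.
rewrite /phi1_mx entire_mx_conjZ ?minkowskiC_unit //.
by rewrite mulmxDr -scalemxAr !mulmxA mulmxKV ?minkowskiC_unit.
Qed.

End WickReality.

(** * Equivariance of the scheme under an invertible change of frame *)

Lemma ss2_mid_frame_change (R : realType) (P : 'M[R[i]]_4)
    (G G' : 'cV[R[i]]_4 -> 'M[R[i]]_4) (h : R) (y u : 'cV[R[i]]_4) :
  P \in unitmx -> G' (P *m y) = P *m G y *m invmx P ->
  ss2_mid G' h (P *m y) (P *m u) = P *m ss2_mid G h y u.
Proof.
move=> uP Gy; rewrite /ss2_mid Gy /phi1_mx entire_mx_conjZ //.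
by rewrite mulmxDr -scalemxAr !mulmxA mulmxKV.
Qed.

(** The hypotheses ask for the transformation law only at the two points where
    one step evaluates the tensor, because [G'] may be prescribed only on the
    image of the physical states. *)
Lemma ss2_step_frame_change (R : realType) (P : 'M[R[i]]_4)
    (G G' : 'cV[R[i]]_4 -> 'M[R[i]]_4) (h : R) (y u : 'cV[R[i]]_4) :
  P \in unitmx ->
  G' (P *m y) = P *m G y *m invmx P ->
  G' (P *m ss2_mid G h y u) = P *m G (ss2_mid G h y u) *m invmx P ->
  ss2_step G' h (frame_change P (y, u)) = frame_change P (ss2_step G h (y, u)).
Proof.
move=> uP Gy Gmid; rewrite /frame_change /ss2_step /=.
rewrite (ss2_mid_frame_change _ P G) // Gmid Gy -mulmxBl -mulmxBr.
rewrite /exp_mx /phi1_mx !entire_mx_conjZ //.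
set X := entire_mx _ _; set Y := entire_mx _ _; set Z := entire_mx _ _.
(* Left transparent, these limits would be unfolded during unification. *)
clearbody X Y Z.
have conj_sum : 1%:M + P *m Y *m invmx P *m (P *m Z *m invmx P) =
    P *m (1%:M + Y *m Z) *m invmx P.
  by rewrite mulmxDr mulmxDl mulmx1 mulmxV // !mulmxA mulmxKV.
congr pair; last by rewrite !mulmxA !mulmxKV.
by rewrite conj_sum [RHS]mulmxDr -scalemxAr !mulmxA !mulmxKV.
Qed.

(** * Lorentz invariance *)

Theorem proposition2p3 (R : realType) (eps h : R)
    (heps0 : 0 < eps) (heps1 : eps < 1) (hh : 0 < h)
    (U : 'cV[R]_3 -> R) (E B : 'cV[R]_3 -> 'cV[R]_3)
    (hU : forall x : 'cV[R]_3, differentiable U x)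
    (hE : forall x : 'cV[R]_3, E x = - grad U x)
    (L : 'M[R]_4) (hL : lorentz L)
    (F' : 'cV[R[i]]_4 -> 'M[R[i]]_4)
    (hF' : forall (x : 'cV[R]_3) (t : R),
      let LC := map_mx (real_complex R) L in
      F' (LC *m fourvec x t) = LC *m em_tensor eps E B x *m invmx LC)
    (x v : 'cV[R]_3) (t gamma : R) :
  let LC := map_mx (real_complex R) L in
  let F := fun y : 'cV[R[i]]_4 => em_tensor eps E B (spatial y) in
  let p := (fourvec x t, fourvec v gamma) in
  ss2_step F' h (frame_change LC p) = frame_change LC (ss2_step F h p).
Proof.
move=> LC F p.
have F_transforms y : wick_real_vec R y ->
    F' (LC *m y) = LC *m F y *m invmx LC.
  by move=> /wick_realP[x' [s ->]]; rewrite hF' /F spatial_fourvec.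
apply: ss2_step_frame_change.
- by rewrite map_unitmx lorentz_unitmx.
- exact/F_transforms/wick_real_fourvec.
- apply/F_transforms/wick_real_mid; last exact: wick_real_fourvec.
    exact: wick_real_em_tensor.
  exact: wick_real_fourvec.
Qed.
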